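(* Let $|\!|\!|\cdot|\!|\!|$ be a norm on $\mathbb{R}^{n_1\times n_2}$, let $\gamma>0$, let $\kappa$ be a positive integer, and let $c_l,c_u>0$ be constants such that $c_l\|\cdot\|_F\le|\!|\!|\cdot|\!|\!|\le c_u\|\cdot\|_F$. Put $\Omega=\{X\in\mathbb{R}^{n_1\times n_2} : |\!|\!|X|\!|\!|\le\gamma\}$ and $\mathcal{F}=\{X\in\Omega : \mathrm{rank}(X)\le\kappa\}$. Then for any $X\in\Omega$ with singular value decomposition $X=\sum_{i=1}^n\sigma_i(X)u_iv_i^{\mathbb{T}}$, $$\mathrm{dist}(X,\mathcal{F})\le\sqrt{1+c_u^2/c_l^2}\;\big\|X-\Pi_{\mathcal{R}}(X)\big\|_F\quad\text{with}\quad \Pi_{\mathcal{R}}(X):=\sum_{i=1}^{\kappa}\sigma_i(X)u_iv_i^{\mathbb{T}}.$$ In particular, $$\Gamma(t)\subseteq\Gamma(0)+\sqrt{1+c_u^2/c_l^2}\;|t|\,\mathbb{B}_{\mathbb{R}^{n_1\times n_2}}\quad\text{for all } t\in\mathbb{R},$$ where $\Gamma(t)=\{X\in\Omega : \sum_{i=\kappa+1}^n\sigma_i(X)=t\}$. When $|\!|\!|\cdot|\!|\!|$ is unitarily invariant, the constant $\sqrt{1+c_u^2/c_l^2}$ above can be replaced by $1$.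
   Context: $n=\min(n_1,n_2)$. $\|\cdot\|_F$ is the Frobenius norm and $\mathrm{dist}$ is the distance in this norm. $\sigma_1(X)\ge\cdots\ge\sigma_n(X)\ge0$ are the singular values of $X$ (with $\sigma_i(X)=0$ for $i>n$ and empty sums equal to $0$), and the $u_i\in\mathbb{R}^{n_1}$ and $v_i\in\mathbb{R}^{n_2}$ are orthonormal. $\mathbb{B}_{\mathbb{R}^{n_1\times n_2}}$ is the closed unit ball in $\|\cdot\|_F$ centered at the origin. *)

(* Defs.v *)
From mathcomp Require Import all_boot all_order all_algebra.
From mathcomp Require Import polyrcf.
From mathcomp Require Import all_classical all_reals.

Set Implicit Arguments.
Unset Strict Implicit.
Unset Printing Implicit Defensive.

Import Order.TTheory GRing.Theory Num.Theory.
Local Open Scope classical_set_scope.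
Local Open Scope ring_scope.

(* The matrix norm of MathComp-Analysis is the max norm, hence the explicit
   definition of the Frobenius norm and of its distance. *)
Definition frob (R : realType) (m n : nat) (X : 'M[R]_(m, n)) : R :=
  Num.sqrt (\sum_i \sum_j X i j ^+ 2).

(* Infimum of a set of nonnegative reals. [inf] is 0 on the empty set, so this
   is the distance only for nonempty [A]. *)
Definition frob_dist (R : realType) (m n : nat)
    (X : 'M[R]_(m, n)) (A : set 'M[R]_(m, n)) : R :=
  inf [set frob (X - Y) | Y in A].

Definition frob_unit_ball (R : realType) (m n : nat) : set 'M[R]_(m, n) :=
  [set Z | frob Z <= 1].

Definition is_norm (R : realType) (m n : nat) (nu : 'M[R]_(m, n) -> R) : Prop :=
  [/\ forall X, 0 <= nu X,
      forall X, nu X = 0 -> X = 0,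
      forall (a : R) X, nu (a *: X) = `|a| * nu X
    & forall X Y, nu (X + Y) <= nu X + nu Y].

Definition orthogonal_mx (R : realType) (n : nat) (U : 'M[R]_n) : Prop :=
  U^T *m U = 1%:M.

Definition unitarily_invariant (R : realType) (m n : nat)
    (nu : 'M[R]_(m, n) -> R) : Prop :=
  forall (U : 'M[R]_m) (V : 'M[R]_n) (X : 'M[R]_(m, n)),
    orthogonal_mx U -> orthogonal_mx V -> nu (U *m X *m V) = nu X.

(* The real eigenvalues of [A], each repeated according to its algebraic
   multiplicity (its multiplicity as a root of [char_poly A]), in nonincreasing
   order. *)
Definition eigenvalues (R : realType) (n : nat) (A : 'M[R]_n) : seq R :=
  let p := char_poly A in
  sort >=%R (flatten [seq nseq (mup a p) a | a <- rootsR p]).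

(* Indices start at 0: [singular_value X i] is the (i+1)-st largest singular
   value of [X]. It is 0 when [minn m n <= i]: either [i] is out of the range
   of the list, or [m < n] and the eigenvalue of [X^T *m X] is 0 as its rank is
   at most [m]. *)
Definition singular_value (R : realType) (m n : nat) (X : 'M[R]_(m, n))
    (i : nat) : R :=
  Num.sqrt (nth 0 (eigenvalues (X^T *m X)) i).

Definition orthonormal_family (R : realType) (k m : nat)
    (u : 'I_k -> 'cV[R]_m) : Prop :=
  forall i j, (u i)^T *m u j = ((i == j)%:R)%:M.

Definition is_svd (R : realType) (m n : nat) (X : 'M[R]_(m, n))
    (u : 'I_(minn m n) -> 'cV[R]_m) (v : 'I_(minn m n) -> 'cV[R]_n) : Prop :=
  [/\ orthonormal_family u,
      orthonormal_family v
    & X = \sum_(i < minn m n) singular_value X i *: (u i *m (v i)^T)].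

Definition svd_truncation (R : realType) (m n kappa : nat) (X : 'M[R]_(m, n))
    (u : 'I_(minn m n) -> 'cV[R]_m) (v : 'I_(minn m n) -> 'cV[R]_n) :
    'M[R]_(m, n) :=
  \sum_(i < minn m n | (i < kappa)%N) singular_value X i *: (u i *m (v i)^T).

Definition Omega (R : realType) (m n : nat) (nu : 'M[R]_(m, n) -> R)
    (gamma : R) : set 'M[R]_(m, n) :=
  [set X | nu X <= gamma].

Definition rank_feasible (R : realType) (m n : nat) (nu : 'M[R]_(m, n) -> R)
    (gamma : R) (kappa : nat) : set 'M[R]_(m, n) :=
  [set X | Omega nu gamma X /\ (\rank X <= kappa)%N].

Definition Gamma (R : realType) (m n : nat) (nu : 'M[R]_(m, n) -> R)
    (gamma : R) (kappa : nat) (t : R) : set 'M[R]_(m, n) :=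
  [set X | Omega nu gamma X /\
           \sum_(kappa <= i < minn m n) singular_value X i = t].

(* Main.v *)
(* The truncation of [X] is [X *m E], with [E] the orthogonal projection
   onto the span of the [kappa] leading right singular vectors, so that
   [X - X *m E] and [X *m E] are orthogonal. If [X *m E] leaves the [nu]-ball,
   the feasible point is its multiple on the sphere: the triangle inequality for
   [nu] bounds the length of the shrinkage by [cu / cl * frob (X - X *m E)], and
   Pythagoras gives the constant. If [nu] is unitarily invariant, [X *m E] is
   the midpoint of [X] and its image under the orthogonal matrix [2 *: E - 1], hence
   stays in the ball. For [Gamma] a basis of right singular vectors comes from
   the spectral theorem for [X^T *m X], and the squared distance to [X *m E] is
   the sum of the squares of the remaining singular values. *)
Require Import Defs.
From mathcomp Require Import all_boot all_order all_algebra.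
From mathcomp Require Import all_classical all_reals.
From mathcomp Require Import perm polyrcf complex spectral ring lra.

Set Implicit Arguments.
Unset Strict Implicit.
Unset Printing Implicit Defensive.

Import Order.TTheory GRing.Theory Num.Theory.
Local Open Scope classical_set_scope.
Local Open Scope ring_scope.

(** * Orthogonal diagonalization of real symmetric matrices *)

(** Over the complex extension [A] becomes Hermitian, so its spectral diagonal is real; the size
    [n.+1] provides an entry to pick. *)
Lemma symmetric_eigenvalue (R : rcfType) (n : nat) (A : 'M[R]_n.+1) :
  A^T = A -> exists a, eigenvalue A a.
Proof.
move=> symA; set Ac := map_mx (real_complex R) A.
have realAc : Ac \is a mxOver Num.real.
  by apply/mxOverP => i j; rewrite mxE; apply/complex_realP; exists (A i j).
have symAc : Ac \is symmetricmx.
  by apply/is_hermitianmxP; rewrite expr0 scale1r map_mx_id //;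
    apply/matrixP => i j; rewrite !mxE -{1}symA mxE.
have hermAc := realsym_hermsym symAc realAc.
have /orthomx_spectralP AcE := hermitian_normalmx hermAc.
have /mxOverP/(_ 0 0)/complex_realP[a da] :=
  hermitian_spectral_diag_real hermAc.
(* The embedding of [R] into its complex extension reflects roots of the characteristic polynomial,
   so a complex eigenvector for [a] is enough: row 0 of [P]. *)
exists a; rewrite eigenvalue_root_char -(fmorph_root (real_complex R)).
rewrite map_char_poly -eigenvalue_root_char.
set P := spectralmx Ac in AcE; set d := spectral_diag Ac in AcE da.
have uP : P \in unitmx := spectral_unit Ac.
apply/eigenvalueP; exists (row 0 P).
  rewrite -/Ac AcE !mulmxA -!row_mul mulmxV // mul1mx.
  by rewrite mul_diag_mx; apply/rowP => j; rewrite !mxE da.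
apply: contraTneq uP => P0; rewrite unitmxE; apply/negP => /unitrP[].
rewrite (expand_det_row _ 0) big1.
  by move=> ? [_]; rewrite mul0r => /esym/eqP; rewrite oner_eq0.
by move=> j _; move/rowP: P0 => /(_ j); rewrite !mxE => ->; rewrite mul0r.
Qed.

(* The witness is the Householder reflection exchanging [v] and the first basis
   vector. *)
Lemma reflection_to_unit (R : realFieldType) (n : nat) (v : 'rV[R]_n.+1) :
  v *m v^T = 1%:M ->
  exists H : 'M[R]_n.+1, [/\ H^T = H, H *m H = 1%:M & delta_mx 0 0 *m H = v].
Proof.
move=> v1; set e : 'rV[R]_n.+1 := delta_mx 0 0.
have e1 : e *m e^T = 1%:M.
  by apply/matrixP => i j; rewrite !ord1 trmx_delta mul_delta_mx !mxE.
have [ve|vNe] := eqVneq v e.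
  by exists 1%:M; rewrite trmx1 mul1mx mulmx1 ve.
move wE: (v - e) => w; set a : R := (v *m e^T) 0 0.
have ve : v *m e^T = a%:M by rewrite [LHS]mx11_scalar.
have ev : e *m v^T = a%:M by rewrite -[LHS]trmxK trmx_mul trmxK ve tr_scalar_mx.
have ww : w *m w^T = (2 - 2 * a)%:M.
  rewrite -wE linearB /= mulmxBl !mulmxBr v1 e1 ve ev -!raddfB /=.
  by congr _%:M; ring.
(* This is the squared length of [w = v - e], the normal of the reflection; it vanishes only if
   [v = e]. *)
have s0 : 2 - 2 * a != 0.
  apply: contra_neq vNe => s0; apply/eqP; rewrite -subr_eq0 wE.
  have /eqP : \sum_i w 0 i ^+ 2 = 0.
    transitivity ((w *m w^T) 0 0).
      by rewrite [RHS]mxE; apply: eq_bigr => i _; rewrite expr2 [w^T _ _]mxE.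
    by rewrite ww s0 mxE mul0rn.
  rewrite psumr_eq0 => [|i _]; last exact: sqr_ge0.
  move=> /allP w0; apply/eqP/rowP => i.
  have /eqP := w0 i (mem_index_enum _).
  by move=> /eqP; rewrite sqrf_eq0 => /eqP ->; rewrite mxE.
exists (1%:M - (2 / (2 - 2 * a)) *: (w^T *m w)); split.
- by rewrite linearB /= linearZ /= trmx_mul trmxK trmx1.
- have wwww : w^T *m w *m (w^T *m w) = (2 - 2 * a) *: (w^T *m w).
    by rewrite mulmxA -(mulmxA _ w) ww mul_mx_scalar -scalemxAl.
  rewrite mulmxBl !mulmxBr !mul1mx mulmx1 -scalemxAl -scalemxAr wwww.
  rewrite !scalerA -addrA -opprD -scalerBl -scalerDl.
  set b := (X in X *: _); have -> : b = 0 by rewrite /b; field.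
  by rewrite scale0r subr0.
- rewrite mulmxBr mulmx1 -scalemxAr mulmxA -{1}wE linearB /= mulmxBr ev e1.
  rewrite -raddfB /= mul_scalar_mx scalerA.
  have -> : 2 / (2 - 2 * a) * (a - 1) = -1 by field.
  by rewrite scaleN1r opprK -wE addrC subrK.
Qed.

(** Induction on the size: a reflection moves a unit eigenvector to the first basis vector, and the
    conjugated matrix splits into a 1 by 1 block and a smaller symmetric block. *)
Lemma symmetric_diagonalization (R : rcfType) (n : nat) (A : 'M[R]_n) :
  A^T = A ->
  exists (Q : 'M[R]_n) (d : 'rV[R]_n),
    Q^T *m Q = 1%:M /\ A = Q *m diag_mx d *m Q^T.
Proof.
elim: n A => [|n IHn] A symA.
  by exists 1%:M, 0; split; apply/matrixP => -[].
have [a /eigenvalueP[v0 v0A v0_neq0]] := symmetric_eigenvalue symA.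
have v0v0 : 0 < (v0 *m v0^T) 0 0.
  rewrite mxE lt_def sumr_ge0 ?andbT => [|i _]; last first.
    by rewrite mxE -expr2 sqr_ge0.
  rewrite psumr_eq0 => [|i _]; last by rewrite mxE -expr2 sqr_ge0.
  apply: contra v0_neq0 => /allP w0; apply/eqP/rowP => i.
  have /eqP := w0 i (mem_index_enum _); rewrite !mxE => /eqP.
  by rewrite mulf_eq0 orbb => /eqP.
pose v := (Num.sqrt ((v0 *m v0^T) 0 0))^-1 *: v0.
have vA : v *m A = a *: v by rewrite /v -scalemxAl v0A !scalerA mulrC.
have v1 : v *m v^T = 1%:M.
  rewrite linearZ -scalemxAl -scalemxAr /= scalerA -invfM -expr2.
  rewrite sqr_sqrtr ?ltW // {2}[v0 *m _]mx11_scalar -scalemx1.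
  by rewrite scalerA mulVf ?gt_eqF // scale1r.
have [H [symH HH eH]] := reflection_to_unit v1.
have vH : v *m H = delta_mx 0 0 by rewrite -eH -mulmxA HH mulmx1.
pose B : 'M[R]_(1 + n) := H *m A *m H.
have symB : B^T = B by rewrite /B !trmx_mul symA symH mulmxA.
have rowB : row 0 B = a *: delta_mx 0 0.
  by rewrite rowE /B !mulmxA eH vA -scalemxAl vH.
have AE : A = H *m B *m H by rewrite /B !mulmxA HH mul1mx -mulmxA HH mulmx1.
clearbody B.
(* The first row of [B] fixes the two upper blocks; symmetry then clears the lower left one. *)
have urB : ursubmx B = 0.
  apply/matrixP => i j; rewrite !mxE (ord1 i).
  have : row 0 B 0 (rshift 1 j) = 0 by rewrite rowB !mxE andbF mulr0.
  by rewrite mxE => <-; congr (B _ _); apply/val_inj.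
have dlB : dlsubmx B = 0 by rewrite -symB -trmx_ursub urB trmx0.
have ulB : ulsubmx B = a%:M.
  rewrite [LHS]mx11_scalar !mxE; congr _%:M.
  have : row 0 B 0 0 = a by rewrite rowB !mxE eqxx mulr1.
  by rewrite mxE => <-; congr (B _ _); apply/val_inj.
have [Q [d [QQ drB]]] : exists (Q : 'M[R]_n) (d : 'rV[R]_n),
    Q^T *m Q = 1%:M /\ drsubmx B = Q *m diag_mx d *m Q^T.
  by apply: IHn; rewrite trmx_drsub symB.
pose K : 'M[R]_(1 + n) := block_mx 1%:M 0 0 Q.
have trK : K^T = block_mx 1%:M 0 0 Q^T by rewrite tr_block_mx !trmx0 trmx1.
have KK : K^T *m K = 1%:M.
  by rewrite trK mulmx_block !(mulmx0, mul0mx, addr0, add0r) mulmx1 QQ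
             -scalar_mx_block.
have BE : B = K *m diag_mx (row_mx a%:M d) *m K^T.
  rewrite -[LHS]submxK urB dlB ulB drB.
  have -> : diag_mx (row_mx a%:M d) = block_mx a%:M 0 0 (diag_mx d).
    rewrite diag_mx_row; congr block_mx.
    by apply/matrixP => i j; rewrite !ord1 !mxE eqxx.
  by rewrite trK !mulmx_block !(mulmx0, mul0mx, addr0, add0r) mul1mx mulmx1.
exists (H *m K), (row_mx a%:M d); split.
  by rewrite trmx_mul symH -mulmxA (mulmxA H) HH mul1mx.
by rewrite AE BE trmx_mul symH !mulmxA.
Qed.

(** * The ordered list of eigenvalues *)

Lemma char_poly_orthogonal_conj (R : comNzRingType) (n : nat) (Q D : 'M[R]_n) :
  Q^T *m Q = 1%:M -> char_poly (Q *m D *m Q^T) = char_poly D.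
Proof.
move=> QQ; have QQt := mulmx1C QQ.
rewrite /char_poly.
have -> : char_poly_mx (Q *m D *m Q^T)
  = map_mx polyC Q *m char_poly_mx D *m map_mx polyC Q^T.
  rewrite /char_poly_mx mulmxBr mulmxBl !map_mxM; congr (_ - _).
  by rewrite mul_mx_scalar -scalemxAl -map_mxM QQt map_mx1 scalemx1.
by rewrite !det_mulmx mulrAC -det_mulmx -map_mxM QQt map_mx1 det1 mul1r.
Qed.

Lemma mup_prod_XsubC (R : fieldType) (s : seq R) (x : R) :
  mup x (\prod_(a <- s) ('X - a%:P)) = count_mem x s.
Proof.
elim: s => [|a s IHs]; first by rewrite big_nil mupNroot // root1.
rewrite big_cons mupM ?polyXsubC_eq0 //; last first.
  by rewrite monic_neq0 // monic_prod_XsubC.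
by rewrite IHs -['X - a%:P]expr1 mup_XsubCX /= eq_sym; case: eqP.
Qed.

(** Occurrences of each [x] are compared: [rootsR p] has no duplicates, so [x] is listed [mup x p]
    times, which is 0 off the roots. This identifies [eigenvalues] with the diagonal of any
    orthogonal diagonalization. *)
Lemma perm_roots_with_mult (R : rcfType) (s : seq R) (p : {poly R}) :
  p = \prod_(a <- s) ('X - a%:P) ->
  perm_eq (flatten [seq nseq (mup a p) a | a <- rootsR p]) s.
Proof.
move=> pE; have p0 : p != 0 by rewrite pE monic_neq0 // monic_prod_XsubC.
have uniq_roots : uniq (rootsR p).
  by apply: (sorted_uniq lt_trans ltxx); exact: sorted_roots.
apply/allP => x _; apply/eqP.
rewrite count_flatten -map_comp.
have -> : sumn [seq (count_mem x \o (fun a => nseq (mup a p) a)) i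
                | i <- rootsR p]
  = (\sum_(a <- rootsR p) (x == a) * mup a p)%N.
  rewrite sumnE big_map; apply: eq_bigr => a _ /=.
  by rewrite count_nseq /= eq_sym.
rewrite -[RHS]mup_prod_XsubC -pE.
have [xr|xNr] := boolP (x \in rootsR p).
  rewrite (bigD1_seq x) //= eqxx mul1n big1 ?addn0 // => a.
  by rewrite eq_sym => /negPf->.
rewrite big1_seq => [|a /= ar]; last by case: eqP xNr ar => // <- /negPf->.
rewrite mupNroot //; apply: contra xNr.
by have := roots_on_rootsR p0 x; rewrite inE => <- //.
Qed.

(** The columns of a diagonalizing matrix are permuted so that the diagonal appears in the order of
    [eigenvalues A]. *)
Lemma spectral_theorem (R : realType) (n : nat) (A : 'M[R]_n) :
  A^T = A ->
  exists2 Q : 'M[R]_n, Q^T *m Q = 1%:M &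
    A = Q *m diag_mx (\row_i nth 0 (eigenvalues A) i) *m Q^T.
Proof.
move=> /symmetric_diagonalization[Q [d [QQ AE]]].
have : perm_eq (eigenvalues A) [tuple d 0 i | i < n].
  rewrite /eigenvalues perm_sort; apply: perm_roots_with_mult.
  rewrite {1}AE char_poly_orthogonal_conj // char_poly_trig ?diag_mx_is_trig //.
  rewrite big_map big_enum /=; apply: eq_bigr => i _.
  by rewrite mxE eqxx.
case/tuple_permP => s eigE.
have nthE i : nth 0 (eigenvalues A) (i : 'I_n) = d 0 (s i).
  by rewrite eigE -tnth_nth !tnth_mktuple.
exists (\matrix_(i, j) Q i (s j)).
  apply/matrixP => i j.
  have /matrixP/(_ (s i) (s j)) := QQ; rewrite !mxE (inj_eq perm_inj) => <-.
  by apply: eq_bigr => k _; rewrite !mxE.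
rewrite {1}AE !mul_mx_diag; apply/matrixP => i j; rewrite !mxE.
rewrite (reindex_inj (@perm_inj _ s)); apply: eq_bigr => k _.
by rewrite !mxE nthE.
Qed.

Lemma sorted_eigenvalues (R : realType) (n : nat) (A : 'M[R]_n) :
  sorted >=%R (eigenvalues A).
Proof. by rewrite /eigenvalues sort_sorted // => x y; exact: ge_total. Qed.

(** * Eigenvalues of the Gram matrix and singular values *)

Lemma frob_sqr (R : realType) (m n : nat) (X : 'M[R]_(m, n)) :
  frob X ^+ 2 = \tr (X^T *m X).
Proof.
rewrite sqr_sqrtr; last by do 2![apply: sumr_ge0 => ? _]; exact: sqr_ge0.
rewrite exchange_big; apply: eq_bigr => j _; rewrite mxE.
by apply: eq_bigr => i _; rewrite mxE expr2.
Qed.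

Lemma gram_sym (R : realType) (m n : nat) (X : 'M[R]_(m, n)) :
  (X^T *m X)^T = X^T *m X.
Proof. by rewrite trmx_mul trmxK. Qed.

Section GramEigenvalues.
Variables (R : realType) (m n : nat) (X : 'M[R]_(m, n)).
Let lambda := nth 0 (eigenvalues (X^T *m X)).

(** The eigenvalue is the squared length of column [i] of [X *m Q]. *)
Lemma gram_eigenvalue_ge0 (i : 'I_n) : 0 <= lambda i.
Proof.
have [Q QQ] := spectral_theorem (gram_sym X).
move=> /(congr1 (fun A => Q^T *m A *m Q)).
rewrite !mulmxA QQ mul1mx -(mulmxA _ Q^T) QQ mulmx1 -trmx_mul -mulmxA.
move=> /matrixP/(_ i i); rewrite [RHS]mxE [in RHS]mxE eqxx mulr1n.
rewrite -/(lambda i) => <-.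
by rewrite mxE; apply: sumr_ge0 => k _; rewrite mxE -expr2 sqr_ge0.
Qed.

(** By contraposition: if [lambda i] is positive, so are the eigenvalues before it, and the diagonal
    form of the Gram matrix has rank at least [i.+1], while its rank is at most that of [X]. *)
Lemma gram_eigenvalue_eq0 (i : 'I_n) : (\rank X <= i)%N -> lambda i = 0.
Proof.
have [Q QQ AE] := spectral_theorem (gram_sym X).
apply: contraTeq => li0; rewrite -ltnNge.
have li : 0 < lambda i by rewrite lt_def li0 gram_eigenvalue_ge0.
(* Past the end of the list [nth] would return the default 0, against [li0]. *)
have lt_size : (i < size (eigenvalues (X^T *m X)))%N.
  by rewrite ltnNge; apply: contra li0 => ?; rewrite /lambda nth_default.
have lj (j : 'I_n) : (j <= i)%N -> lambda j != 0.
  move=> ji; rewrite gt_eqF // (lt_le_trans li) //.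
  apply: (sorted_leq_nth (rev_trans le_trans) (@lexx _ _) _
            (sorted_eigenvalues _)) => //.
  by rewrite inE (leq_ltn_trans ji).
pose D : 'M[R]_n := diag_mx (\row_j lambda j).
have rD : (\rank D <= \rank X)%N.
  have -> : D = Q^T *m (X^T *m X) *m Q.
    by rewrite {1}AE !mulmxA QQ mul1mx -mulmxA QQ mulmx1.
  rewrite mulmxA (leq_trans (mxrankM_maxl _ _)) //.
  exact: mxrankM_maxr.
apply: leq_trans rD.
(* The truncated identity of rank [i.+1] is a multiple of [D]: the first [i.+1] diagonal entries are
   inverted, the others sent to 0. *)
have <- : \rank (pid_mx i.+1 : 'M[R]_n) = i.+1 by rewrite rank_pid_mx.
have -> : (pid_mx i.+1 : 'M[R]_n)
  = D *m
    diag_mx (\row_(j < n) if (j <= i)%N then (lambda j)^-1 else 0).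
  rewrite mulmx_diag; apply/matrixP => j k; rewrite !mxE ltnS.
  rewrite -[(j == k :> nat)]/(j == k).
  case: (eqVneq j k) => _; last by rewrite mulr0n.
  case: leqP => ji; first by rewrite mulfV // lj.
  by rewrite mulr0.
exact: mxrankM_maxl.
Qed.

Lemma singular_value_ge0 (i : nat) : 0 <= singular_value X i.
Proof. exact: sqrtr_ge0. Qed.

Lemma singular_value_sqr (i : 'I_n) : singular_value X i ^+ 2 = lambda i.
Proof. by rewrite sqr_sqrtr // gram_eigenvalue_ge0. Qed.

Lemma singular_value_eq0 (i : 'I_n) :
  (\rank X <= i)%N -> singular_value X i = 0.
Proof.
by move=> rX; rewrite /singular_value -/(lambda i) gram_eigenvalue_eq0 ?sqrtr0.
Qed.

End GramEigenvalues.

(** * Projections onto the leading vectors of an orthonormal family *)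

(** The length [k] is free in order to cover both the [minn m n] right vectors of a given
    decomposition and a full eigenbasis of the Gram matrix. *)
Definition head_projection (R : realType) (k n kappa : nat)
    (v : 'I_k -> 'cV[R]_n) : 'M[R]_n :=
  \sum_(i < k | (i < kappa)%N) v i *m (v i)^T.

Section HeadProjection.
Variables (R : realType) (k n kappa : nat) (v : 'I_k -> 'cV[R]_n).
Hypothesis v_orthonormal : orthonormal_family v.
Let E := head_projection kappa v.

Lemma tr_head_projection : E^T = E.
Proof.
by rewrite linear_sum; apply: eq_bigr => i _; rewrite /= trmx_mul trmxK.
Qed.

Lemma mulmx_head_projection (j : 'I_k) :
  (v j)^T *m E = if (j < kappa)%N then (v j)^T else 0.
Proof.
rewrite mulmx_sumr.
under eq_bigr do rewrite mulmxA v_orthonormal mul_scalar_mx.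
case: ifPn => jk.
  rewrite (bigD1 j) //= eqxx scale1r big1 ?addr0 // => i /andP[_].
  by rewrite eq_sym => /negPf->; rewrite scale0r.
rewrite big1 // => i ik; case: eqP => [ji|_]; last by rewrite scale0r.
by rewrite ji ik in jk.
Qed.

Lemma head_projection_idem : E *m E = E.
Proof.
rewrite {1}/E mulmx_suml; apply: eq_bigr => i ik.
by rewrite -mulmxA mulmx_head_projection ik.
Qed.

(** A sum of at most [kappa] matrices of rank at most 1. *)
Lemma rank_head_projection : (\rank E <= kappa)%N.
Proof.
apply: (@leq_trans (\sum_(i < k | (i < kappa)%N) 1)%N).
  rewrite /E /head_projection.
  elim/big_ind2: _ => [|a A b B ha hb|i _]; first by rewrite mxrank0.
    by rewrite (leq_trans (mxrank_add _ _)) ?leq_add.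
  by rewrite (leq_trans (mxrankM_maxr _ _)) ?rank_leq_row.
(* As [kappa] may exceed [k], the indices are counted as a duplicate-free sublist of
   [iota 0 kappa]. *)
rewrite -(big_mkord (fun i => i < kappa)%N (fun=> 1%N)) sum1_count -size_filter.
rewrite -[leqRHS](size_iota 0) uniq_leq_size ?filter_uniq ?iota_uniq // => i.
by rewrite mem_filter mem_iota => /andP[].
Qed.

End HeadProjection.

(** * Frobenius norm and Pythagoras *)

Lemma frob_ge0 (R : realType) (m n : nat) (X : 'M[R]_(m, n)) : 0 <= frob X.
Proof. exact: sqrtr_ge0. Qed.

Lemma frobZ (R : realType) (m n : nat) (a : R) (X : 'M[R]_(m, n)) :
  frob (a *: X) = `|a| * frob X.
Proof.
rewrite /frob -sqrtr_sqr -sqrtrM ?sqr_ge0 //; congr Num.sqrt.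
rewrite mulr_sumr; apply: eq_bigr => i _; rewrite mulr_sumr.
by apply: eq_bigr => j _; rewrite mxE exprMn.
Qed.

(** The hypothesis is orthogonality for the trace inner product; the other cross term is the trace
    of the transpose. *)
Lemma frob_sqr_orthD (R : realType) (m n : nat) (X Y : 'M[R]_(m, n)) :
  \tr (X^T *m Y) = 0 -> frob (X + Y) ^+ 2 = frob X ^+ 2 + frob Y ^+ 2.
Proof.
move=> XY; rewrite !frob_sqr mulmxDr !linearD /= !mulmxDl !linearD /= XY.
by rewrite -(mxtrace_tr (Y^T *m X)) trmx_mul trmxK XY addr0 add0r.
Qed.

(** * Feasible points obtained from an orthogonal projection *)

Section Projection.
Variables (R : realType) (m n : nat) (X : 'M[R]_(m, n)) (E : 'M[R]_n).
Hypotheses (symE : E^T = E) (idemE : E *m E = E).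

Lemma frob_sqr_sub_scale_proj (a : R) :
  frob (X - a *: (X *m E)) ^+ 2
  = frob (X - X *m E) ^+ 2 + ((1 - a) * frob (X *m E)) ^+ 2.
Proof.
have -> : X - a *: (X *m E) = (X - X *m E) + (1 - a) *: (X *m E).
  by rewrite scalerBl scale1r addrA subrK.
rewrite frob_sqr_orthD; last first.
  (* The cross term vanishes by cyclicity of the trace and [E *m E = E]. *)
  rewrite -scalemxAr linearZ /= linearB /= trmx_mul symE mulmxBl linearB /=.
  rewrite -!mulmxA (mxtrace_mulC E) -!mulmxA idemE subrr.
  by rewrite mulr0.
by rewrite frobZ !exprMn real_normK // num_real.
Qed.

(** This form of the residual lets both traces be evaluated in an eigenbasis of the Gram matrix. *)
Lemma frob_sqr_sub_proj :
  frob (X - X *m E) ^+ 2 = \tr (X^T *m X) - \tr (X^T *m X *m E).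
Proof.
rewrite frob_sqr mulmxBr !linearB /= !mulmxBl trmx_mul symE !linearB /=.
rewrite -!mulmxA (mxtrace_mulC E (X^T *m X)) (mxtrace_mulC E) -!mulmxA idemE.
by rewrite subrr subr0.
Qed.

Variables (nu : 'M[R]_(m, n) -> R) (gamma cl cu : R).
Hypotheses (nu_norm : is_norm nu) (gamma_gt0 : 0 < gamma).
Hypotheses (cl_gt0 : 0 < cl) (cu_gt0 : 0 < cu).
Hypothesis nu_frob : forall Z, cl * frob Z <= nu Z /\ nu Z <= cu * frob Z.
Variable kappa : nat.
Hypothesis rankE : (\rank E <= kappa)%N.
Hypothesis X_Omega : Omega nu gamma X.

Lemma rank_feasible_near :
  exists2 Y, rank_feasible nu gamma kappa Y &
    frob (X - Y) <= Num.sqrt (1 + cu ^+ 2 / cl ^+ 2) * frob (X - X *m E).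
Proof.
have [nu0 nu_eq0 nuZ nuD] := nu_norm.
have rXE : (\rank (X *m E) <= kappa)%N.
  by rewrite (leq_trans (mxrankM_maxr _ _)).
have k2 : 0 <= cu ^+ 2 / cl ^+ 2 by rewrite divr_ge0 // sqr_ge0.
(* Inside the ball [X *m E] itself is feasible, and the constant is at least 1. *)
have [pg|pg] := leP (nu (X *m E)) gamma.
  exists (X *m E); first by split.
  apply: ler_peMl; first exact: frob_ge0.
  rewrite -{1}sqrtr1.
  by rewrite ler_wsqrtr // lerDl.
set p := nu (X *m E) in pg *.
have p0 : 0 < p := lt_trans gamma_gt0 pg.
exists ((gamma / p) *: (X *m E)).
  split; last by rewrite (leq_trans (mxrank_scale _ _)).
  rewrite /Omega /= nuZ ger0_norm; last by apply: divr_ge0; exact: ltW.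
  by rewrite -/p divfK ?gt_eqF.
set f := frob (X - X *m E); set F := frob (X *m E).
have f0 : 0 <= f := frob_ge0 _.
have F0 : 0 <= F := frob_ge0 _.
(* The left side is the length of the shrinkage. It equals [(p - gamma) * F / p], where [F / p] is
   at most [1 / cl] and the excess [p - gamma] is at most [cu * f]. *)
have lin : (1 - gamma / p) * F <= cu / cl * f.
  have pF : cl * F <= p by have [] := nu_frob (X *m E).
  have pgf : p - gamma <= cu * f.
    (* [X *m E] is [X] minus the residual, and [nu X] is at most [gamma]. *)
    have pD : p <= nu X + nu ((-1) *: (X - X *m E)).
      by rewrite (le_trans _ (nuD _ _)) // scaleN1r opprB addrC subrK.
    have [_ df] := nu_frob (X - X *m E).
    move: pD; rewrite nuZ normrN1 mul1r => pD.
    rewrite lerBlDr (le_trans pD) // addrC lerD //.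
  have -> : (1 - gamma / p) * F = (p - gamma) * F / p by field; rewrite gt_eqF.
  have -> : cu / cl * f = cu * f / cl by rewrite mulrAC.
  rewrite ler_pdivrMr // mulrAC ler_pdivlMr //.
  apply: (@le_trans _ _ ((p - gamma) * p)).
    by rewrite -mulrA [F * cl]mulrC ler_wpM2l // subr_ge0 ltW.
  by rewrite ler_wpM2r // ltW.
(* After squaring, Pythagoras leaves [f ^+ 2] on both sides and the rest is the square of [lin]. *)
rewrite -ler_sqr ?nnegrE ?mulr_ge0 ?sqrtr_ge0 ?frob_ge0 //.
rewrite frob_sqr_sub_scale_proj [leRHS]exprMn.
rewrite (@sqr_sqrtr _ (1 + cu ^+ 2 / cl ^+ 2)) ?addr_ge0 //.
rewrite [leRHS]mulrDl mul1r lerD2l -expr_div_n -exprMn ler_sqr ?nnegrE //.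
  by rewrite mulr_ge0 // subr_ge0 ler_pdivrMr // mul1r ltW.
by rewrite mulr_ge0 // divr_ge0 // ltW.
Qed.

Lemma unitarily_invariant_proj : unitarily_invariant nu -> nu (X *m E) <= nu X.
Proof.
move=> nuU; have [_ _ nuZ nuD] := nu_norm.
(* This matrix is symmetric, and its square is [4 E - 4 E + 1]. *)
have orthS : orthogonal_mx (2 *: E - 1%:M).
  rewrite /orthogonal_mx; have -> : (2 *: E - 1%:M)^T = 2 *: E - 1%:M.
    by rewrite linearB /= linearZ /= symE trmx1.
  rewrite mulmxBl !mulmxBr -!scalemxAl -!scalemxAr !mulmx1 !mul1mx idemE.
  rewrite scalerA -scalerBl opprB addrA.
  rewrite addrAC -scalerBl.
  have -> : 2 * 2 - 2 - 2 = 0 :> R by ring.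
  by rewrite scale0r add0r.
have orth1 : orthogonal_mx (1%:M : 'M[R]_m).
  by rewrite /orthogonal_mx trmx1 mulmx1.
have nuS : nu (X *m (2 *: E - 1%:M)) = nu X.
  by have := nuU 1%:M _ X orth1 orthS; rewrite mul1mx.
have -> : X *m E = 2^-1 *: (X + X *m (2 *: E - 1%:M)).
  rewrite mulmxBr mulmx1 addrC subrK -scalemxAr scalerA.
  by rewrite mulVf ?pnatr_eq0 // scale1r.
rewrite nuZ ger0_norm ?invr_ge0 // ler_pdivrMl // (le_trans (nuD _ _)) // nuS.
lra.
Qed.

End Projection.

(** * Distances, truncations and tails of singular values *)

Lemma frob_eq0 (R : realType) (m n : nat) (X : 'M[R]_(m, n)) :
  frob X = 0 -> X = 0.
Proof.
move=> /eqP; rewrite -(sqrf_eq0 (frob X)) frob_sqr psumr_eq0 => [/allP X0|j _].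
  apply/matrixP => i j; have := X0 j (mem_index_enum _).
  rewrite /= mxE psumr_eq0 => [/allP/(_ i (mem_index_enum _))|k _]; last first.
    by rewrite mxE -expr2 sqr_ge0.
  by rewrite /= !mxE -expr2 sqrf_eq0 => /eqP.
by rewrite mxE; apply: sumr_ge0 => k _; rewrite mxE -expr2 sqr_ge0.
Qed.

Lemma frob_ball_scale (R : realType) (m n : nat) (r : R) (X : 'M[R]_(m, n)) :
  frob X <= r -> exists2 Z, @frob_unit_ball R m n Z & X = r *: Z.
Proof.
move=> Xr; have r0 : 0 <= r := le_trans (frob_ge0 X) Xr.
(* Radius 0 forces [X = 0], and [X] itself serves as the point of the ball; otherwise [X] is divided
   by [r]. *)
have [rE|rN0] := eqVneq r 0.
  exists X => //=; first by rewrite /frob_unit_ball /= (le_trans Xr) // rE.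
  by rewrite rE scale0r; apply/frob_eq0/eqP; rewrite eq_le frob_ge0 -rE Xr.
exists (r^-1 *: X); last by rewrite scalerA mulfV // scale1r.
rewrite /frob_unit_ball /= frobZ ger0_norm ?invr_ge0 //.
by rewrite ler_pdivrMl ?mulr1 // lt_def rN0.
Qed.

Lemma frob_dist_le (R : realType) (m n : nat) (X Y : 'M[R]_(m, n)) A :
  A Y -> frob_dist X A <= frob (X - Y).
Proof.
move=> AY; apply: ge_inf; last by exists Y.
by exists 0 => _ [Z _ <-]; exact: frob_ge0.
Qed.

Lemma svd_truncationE (R : realType) (m n kappa : nat) (X : 'M[R]_(m, n)) u v :
  is_svd X u v -> svd_truncation kappa X u v = X *m head_projection kappa v.
Proof.
move=> [_ v_on XE]; rewrite [in RHS]XE mulmx_suml /svd_truncation big_mkcond.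
apply: eq_bigr => i _.
rewrite -scalemxAl -mulmxA mulmx_head_projection //.
by case: ifP => // _; rewrite mulmx0 scaler0.
Qed.

(** In the eigenbasis formed by the columns of [Q], the two traces giving the squared residual are
    the sums of all squared singular values and of the first [kappa] ones. *)
Lemma gram_spectral_basis (R : realType) (m n : nat) (X : 'M[R]_(m, n)) :
  exists2 v : 'I_n -> 'cV[R]_n, orthonormal_family v &
    forall kappa, frob (X - X *m head_projection kappa v) ^+ 2
      = \sum_(kappa <= i < minn m n) singular_value X i ^+ 2.
Proof.
have [Q QQ AE] := spectral_theorem (gram_sym X).
set D := diag_mx _ in AE.
have vtE i : (col i Q)^T = delta_mx 0 i *m Q^T by rewrite tr_col rowE.
have v_on : orthonormal_family (fun i => col i Q).
  move=> i j; rewrite vtE colE mulmxA -(mulmxA _ Q^T) QQ mulmx1.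
  by rewrite -rowE; apply/matrixP => k l; rewrite !mxE !ord1 eqxx andbT mulr1n.
exists (fun i => col i Q) => // kappa.
rewrite frob_sqr_sub_proj; last 2 first.
- exact: tr_head_projection.
- exact: head_projection_idem.
have -> : \tr (X^T *m X) = \sum_(i < n) singular_value X i ^+ 2.
  rewrite AE mxtrace_mulC mulmxA QQ mul1mx mxtrace_diag.
  by apply: eq_bigr => i _; rewrite mxE singular_value_sqr.
have -> : \tr (X^T *m X *m head_projection kappa (fun i => col i Q))
    = \sum_(i < n | (i < kappa)%N) singular_value X i ^+ 2.
  rewrite mulmx_sumr linear_sum; apply: eq_bigr => i _ /=.
  rewrite mulmxA mxtrace_mulC mulmxA AE vtE colE !mulmxA.
  rewrite -(mulmxA _ Q^T) QQ mulmx1 -(mulmxA _ Q^T) QQ mulmx1.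
  by rewrite -rowE -colE trace_mx11 !mxE eqxx mulr1n singular_value_sqr.
rewrite (bigID (fun i : 'I_n => (i < kappa)%N)) /= addrC addrK.
rewrite big_geq_mkord.
rewrite (big_ord_widen_cond _ _ (fun i => singular_value X i ^+ 2)
           (geq_minr m n)).
(* Indices from [minn m n] up to [n] occur only if [m < n]; they are then at least [m], hence at
   least the rank, and contribute 0. *)
rewrite (bigID (fun i : 'I_n => (i < minn m n)%N)) /= [X in _ + X]big1 ?addr0.
  by apply: eq_bigl => i; rewrite -leqNgt.
move=> i /andP[_]; rewrite -leqNgt geq_min.
rewrite [(n <= i)%N]leqNgt ltn_ord orbF => mi.
by rewrite singular_value_eq0 ?expr0n // (leq_trans (rank_leq_row X)).
Qed.

(** Nonnegativity of the partial sums is carried through the induction to make the cross terms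
    nonnegative. *)
Lemma sumr_sqr_le (R : realDomainType) (I : Type) (r : seq I) (P : pred I)
    (F : I -> R) :
  (forall i, P i -> 0 <= F i) ->
  \sum_(i <- r | P i) F i ^+ 2 <= (\sum_(i <- r | P i) F i) ^+ 2.
Proof.
move=> F0; suff: \sum_(i <- r | P i) F i ^+ 2 <= (\sum_(i <- r | P i) F i) ^+ 2
  /\ 0 <= \sum_(i <- r | P i) F i by case.
elim/big_ind2: _ => [|x1 x2 y1 y2 [h1 x0] [h2 y0]|i /F0 //].
  by rewrite expr0n.
split; last exact: addr_ge0.
by nra.
Qed.

(** * The inclusion for [Gamma] *)

Lemma rank_feasible_Gamma0 (R : realType) (m n : nat) (nu : 'M[R]_(m, n) -> R)
    (gamma : R) (kappa : nat) :
  rank_feasible nu gamma kappa `<=` Gamma nu gamma kappa 0.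
Proof.
move=> Y [YO rY]; split=> //; rewrite big_nat big1 // => i /andP[ki].
rewrite leq_min => /andP[_ lt_in].
by apply: (singular_value_eq0 (i := Ordinal lt_in)); apply: leq_trans ki.
Qed.

(** The constant and the nearby feasible point are abstracted so that the general and the unitarily
    invariant case share the argument. *)
Lemma Gamma_sub_ball (R : realType) (m n : nat) (nu : 'M[R]_(m, n) -> R)
    (gamma : R) (kappa : nat) (c : R) :
  0 <= c ->
  (forall (X : 'M[R]_(m, n)) (E : 'M[R]_n), E^T = E -> E *m E = E ->
     (\rank E <= kappa)%N -> Omega nu gamma X ->
     exists2 Y, rank_feasible nu gamma kappa Y &
       frob (X - Y) <= c * frob (X - X *m E)) ->
  forall t : R, Gamma nu gamma kappa t `<=`
    [set Y + (c * `|t|) *: Z | Y in Gamma nu gamma kappa 0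
                             & Z in @frob_unit_ball R m n].
Proof.
move=> c0 near t X [XO Xt]; have [v v_on tailE] := gram_spectral_basis X.
have [Y YF XY] := near X _ (tr_head_projection kappa v)
  (head_projection_idem kappa v_on) (rank_head_projection kappa v) XO.
(* The squared residual is the sum of the squared tail singular values, at most the square of their
   sum [t]. *)
have tail : frob (X - X *m head_projection kappa v) <= `|t|.
  rewrite -ler_sqr ?nnegrE ?frob_ge0 // tailE real_normK ?num_real // -Xt.
  by apply: sumr_sqr_le => i _; exact: singular_value_ge0.
have [Z ZB XYE] := frob_ball_scale (le_trans XY (ler_wpM2l c0 tail)).
exists Y; first exact: rank_feasible_Gamma0.
by exists Z => //; rewrite -XYE addrC subrK.
Qed.

Theorem proposition2p1 (R : realType) (n1 n2 : nat)
    (nu : 'M[R]_(n1, n2) -> R) (gamma : R) (kappa : nat) (cl cu : R)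
    (nu_norm : is_norm nu)
    (gamma_gt0 : 0 < gamma) (kappa_gt0 : (0 < kappa)%N)
    (cl_gt0 : 0 < cl) (cu_gt0 : 0 < cu)
    (nu_frob : forall X, cl * frob X <= nu X /\ nu X <= cu * frob X) :
  let c := Num.sqrt (1 + cu ^+ 2 / cl ^+ 2) in
  [/\ forall (X : 'M[R]_(n1, n2))
             (u : 'I_(minn n1 n2) -> 'cV[R]_n1)
             (v : 'I_(minn n1 n2) -> 'cV[R]_n2),
        Omega nu gamma X -> is_svd X u v ->
        frob_dist X (rank_feasible nu gamma kappa)
          <= c * frob (X - svd_truncation kappa X u v),
      forall t : R,
        Gamma nu gamma kappa t `<=`
          [set Y + (c * `|t|) *: Z | Y in Gamma nu gamma kappa 0
                                   & Z in @frob_unit_ball R n1 n2]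
    & unitarily_invariant nu ->
      (forall (X : 'M[R]_(n1, n2))
              (u : 'I_(minn n1 n2) -> 'cV[R]_n1)
              (v : 'I_(minn n1 n2) -> 'cV[R]_n2),
         Omega nu gamma X -> is_svd X u v ->
         frob_dist X (rank_feasible nu gamma kappa)
           <= frob (X - svd_truncation kappa X u v)) /\
      (forall t : R,
         Gamma nu gamma kappa t `<=`
           [set Y + `|t| *: Z | Y in Gamma nu gamma kappa 0
                            & Z in @frob_unit_ball R n1 n2])].
Proof.
(* The distance bound for an arbitrary constant, applied below both to the square root and to 1. *)
have dist_le c :
    (forall (X : 'M[R]_(n1, n2)) (E : 'M[R]_n2), E^T = E -> E *m E = E ->
     (\rank E <= kappa)%N -> Omega nu gamma X ->
     exists2 Y, rank_feasible nu gamma kappa Y &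
       frob (X - Y) <= c * frob (X - X *m E)) ->
    forall X u v, Omega nu gamma X -> is_svd X u v ->
    frob_dist X (rank_feasible nu gamma kappa)
      <= c * frob (X - svd_truncation kappa X u v).
  move=> near X u v XO Xsvd; have [_ v_on _] := Xsvd.
  have [Y YF] := near X _ (tr_head_projection kappa v)
    (head_projection_idem kappa v_on) (rank_head_projection kappa v) XO.
  by rewrite -(svd_truncationE _ Xsvd); apply: le_trans; exact: frob_dist_le.
split.
- by apply: dist_le => X E symE idemE rE XO; exact: rank_feasible_near.
- apply: Gamma_sub_ball; first exact: sqrtr_ge0.
  by move=> X E symE idemE rE XO; exact: rank_feasible_near.
- move=> nuU.
  (* Under unitary invariance [X *m E] stays in the ball, so no shrinkage occurs and the constant is
     1. *)
  have near1 (X : 'M[R]_(n1, n2)) (E : 'M[R]_n2) : E^T = E -> E *m E = E ->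
      (\rank E <= kappa)%N -> Omega nu gamma X ->
      exists2 Y, rank_feasible nu gamma kappa Y &
        frob (X - Y) <= 1 * frob (X - X *m E).
    move=> symE idemE rE XO; exists (X *m E); last by rewrite mul1r.
    split; last by rewrite (leq_trans (mxrankM_maxr _ _)).
    by apply: le_trans XO; exact: unitarily_invariant_proj.
  split=> [X u v XO Xsvd|t].
    by rewrite -[leRHS]mul1r; exact: (dist_le 1 near1).
  by rewrite -[`|t|]mul1r; exact: Gamma_sub_ball.
Qed.
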